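(* There is an absolute constant $C$ such that the following holds. Let $n,h,k$ be positive integers and let $s\ge \max\{k,h^2k^2/n\}$. Every $3$-graph on $n$ vertices with $e\ge Csn^2$ edges contains at least $t=\min\{s,\sqrt{sn}/h,s^{1/3}n^{2/3}/(hk)\}$ vertex-disjoint copies of $\mathit{St}_3(h,k)$.
   Context: A $3$-graph is a $3$-uniform hypergraph. $\mathit{St}_3(h,k)$ is the $3$-graph with a vertex $v$ contained in all edges such that removing $v$ from every edge yields $h$ vertex-disjoint copies of the graph star $S_k$ (a star with $k$ leaves). Floors/ceilings of non-integer quantities are omitted. *)

(* Defs.v *)
From mathcomp Require Import all_boot.

Set Implicit Arguments.
Unset Strict Implicit.
Unset Printing Implicit Defensive.

(* A hypergraph with vertex set a finite type V is given by its edge set,     *)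
(* of type {set {set V}}; graphs are the case where all edges have size 2.    *)
Definition uniform (r : nat) (V : finType) (E : {set {set V}}) : Prop :=
  forall e, e \in E -> #|e| = r.

(* The centre of the star is None, its k leaves are the Some j.               *)
Definition star (k : nat) : {set {set option 'I_k}} :=
  [set [set None; Some j] | j : 'I_k].

Definition disjoint_union (h : nat) (V : finType) (E : {set {set V}}) :
    {set {set 'I_h * V}} :=
  [set [set (i, x) | x in e] | i : 'I_h, e : {set V} in E].

(* None is a new vertex, which is added to every edge.                        *)
Definition cone (V : finType) (E : {set {set V}}) : {set {set option V}} :=
  [set None |: [set Some x | x in e] | e : {set V} in E].

Definition St3 (h k : nat) : {set {set option ('I_h * option 'I_k)}} :=
  cone (disjoint_union h (star k)).

Definition is_copy (W V : finType) (F : {set {set W}}) (G : {set {set V}})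
    (f : W -> V) : Prop :=
  injective f /\ forall e, e \in F -> [set f x | x in e] \in G.

Definition has_disjoint_copies (m : nat) (W V : finType)
    (F : {set {set W}}) (G : {set {set V}}) : Prop :=
  exists f : 'I_m -> W -> V,
    (forall i, is_copy F G (f i)) /\
    (forall i j, i != j -> forall x y, f i x != f j y).

(* Main.v *)
(* Work with ordered triples (apex, star centre, leaf).  If there are at least
   [3m] vertices whose degree exceeds [e / (120 m h)], where [e] is the number
   of triples, then copies are built with apexes among them, choosing stars
   inside their links.  Otherwise these vertices are deleted at small cost.
   Let [B] be the vertices of degree above [e / (90 m h k)]; there are at most
   [90 m h k] of them.  Take copies with no leaf in [B] greedily: used
   vertices of [B] are then few (at most [2 m h]), and the others have small
   degree, so most edges survive.  Call a pair heavy if it has at least [3 h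
   k] common neighbours outside [B].  If the greedy process is stuck, every
   vertex is in fewer than [2 h] heavy pairs, and most surviving edges consist
   of a heavy pair and a third vertex outside [B]: edges inside [B], or with a
   non-heavy pair in [B], number [O((m h k)^3)], and the other edges without
   heavy pairs would give links of maximum degree [3 h k] outside [B] which
   still contain [h] stars. Restart with the third vertices as apexes: the
   heavy pairs form a graph of maximum degree [2 h], so all used vertices
   together destroy few edges. *)

Require Import Defs.
From mathcomp Require Import all_boot all_order all_algebra.
From mathcomp Require Import boolp reals exp zify ring lra.

Set Implicit Arguments.
Unset Strict Implicit.
Unset Printing Implicit Defensive.

(** * Greedy choice of disjoint maps and of distinct representatives *)

Section Greedy.
Variable V : finType.
Implicit Types U B : {set V}.

(** The maps are chosen one after another, and [U] collects the vertices used so far. At most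
    [#|I|.-1] maps come before a given one, each using at most [#|W|] vertices in all and [b] in
    [B]. The separate account for [B] lets a few special vertices, such as those of large degree, be
    charged at their own rate. *)
Lemma greedy_disjoint (I W : finType) (P : I -> (W -> V) -> Prop) B (b : nat) :
  (forall i f, P i f -> #|[set f x | x : W] :&: B| <= b) ->
  (forall i U, #|U| <= #|I|.-1 * #|W| -> #|U :&: B| <= #|I|.-1 * b ->
     exists f, P i f /\ forall x, f x \notin U) ->
  exists F : I -> W -> V, (forall i, P i (F i)) /\
    forall i j, i != j -> forall x y, F i x != F j y.
Proof.
move=> leb step.
have [I0|/card_gt0P[i0 _]] := posnP #|I|.
  have N0 (i : I) : False := fintype0 i I0.
  by exists (fun i => False_rect _ (N0 i)); split=> i; exfalso; exact: N0 i.
(* [f0] only serves as a default value at indices not yet treated. *)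
have [f0 _] : exists f, P i0 f /\ forall x, f x \notin set0.
  by apply: step; rewrite ?set0I cards0.
suff main (s : seq I) : uniq s -> exists F U,
    [/\ #|U| <= size s * #|W|, #|U :&: B| <= size s * b,
        forall i, i \in s -> P i (F i) /\ forall x, F i x \in U &
        forall i j, i \in s -> j \in s -> i != j ->
          forall x y, F i x != F j y].
  have [F [U [_ _ PF FF]]] := main _ (enum_uniq I).
  exists F; split=> [i|i j]; last by apply: FF; rewrite mem_enum.
  by have [] := PF i; rewrite ?mem_enum.
elim: s => [_|i s IH /= /andP[i_s us]].
  by exists (fun _ => f0), set0; rewrite set0I cards0.
have [F [U [cU cUB PF FF]]] := IH us.
have les : size s <= #|I|.-1.
  rewrite -ltnS prednK; last by apply/card_gt0P; exists i.
  have /card_uniqP : uniq (i :: s) by rewrite /= i_s.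
  by rewrite /= => <-; apply: max_card.
have [f [Pf fU]] := step i U (leq_trans cU (leq_mul les (leqnn _)))
   (leq_trans cUB (leq_mul les (leqnn _))).
pose F' j := if j == i then f else F j.
have F's j : j \in s -> F' j = F j.
  by rewrite /F'; case: eqP => // ->; rewrite (negPf i_s).
have F'i : F' i = f by rewrite /F' eqxx.
exists F', (U :|: [set f x | x : W]); split.
- apply: leq_trans (leq_card_setU _ _) _; rewrite mulSn addnC leq_add //.
  exact: leq_imset_card.
- rewrite setIUl; apply: leq_trans (leq_card_setU _ _) _.
  by rewrite mulSn addnC leq_add // (leb i).
- move=> j; rewrite inE => /orP[/eqP->|js].
    by rewrite F'i; split=> // x; rewrite inE imset_f ?orbT.
  rewrite F's //; have [PFj FU] := PF j js.
  by split=> // x; rewrite inE FU.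
- move=> j l; rewrite !inE => /orP[/eqP->|js] /orP[/eqP->|ls].
  + by rewrite eqxx.
  + rewrite F'i F's // => _ x y; apply: contraNneq (fU x) => ->.
    by have [] := PF l ls.
  + rewrite F'i F's // => _ x y; apply: contraNneq (fU y) => <-.
    by have [] := PF j js.
  + by rewrite !F's //; apply: FF.
Qed.

(** Greedy choice of maps from [unit]: fewer than [#|I|] elements are taken at any moment, so no set
    [S i] is exhausted. *)
Lemma distinct_representatives (I : finType) (S : I -> {set V}) :
  (forall i, #|I| <= #|S i|) ->
  exists f : I -> V, injective f /\ forall i, f i \in S i.
Proof.
move=> leS.
have [||F [FS FF]] :=
  @greedy_disjoint I unit (fun i f => f tt \in S i) setT 1.
- move=> i f _; rewrite setIT; apply: leq_trans (leq_imset_card _ _) _.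
  by rewrite card_unit.
- move=> i U; rewrite card_unit muln1 => cU _.
  have : #|U| < #|S i|.
    apply: leq_ltn_trans cU (leq_trans _ (leS i)).
    by rewrite prednK //; apply/card_gt0P; exists i.
  have [/subset_leq_card|/subsetPn [y yS yU]] := boolP (S i \subset U).
    by rewrite leqNgt => /negbTE ->.
  by exists (fun _ => y); split.
exists (fun i => F i tt); split=> // i j eqF.
by apply/eqP; apply: contraT => /FF/(_ tt tt); rewrite eqF eqxx.
Qed.

End Greedy.

(** * Counting ordered pairs and triples; stars and star forests in a link *)

Section Counting.
Variable V : finType.
Implicit Types (L : V -> V -> bool) (T : V -> V -> V -> bool) (U : {set V}).

Definition npairs L := \sum_x \sum_y (L x y : nat).
Definition ntriples T := \sum_x npairs (T x).

Lemma sum_indicator (P : pred V) : \sum_x (P x : nat) = #|[set x | P x]|.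
Proof.
rewrite -sum1_card [RHS]big_mkcond /=; apply: eq_bigr => x _.
by rewrite inE; case: (P x).
Qed.

Lemma sum_leq_card (F : V -> nat) (A : {set V}) (a b : nat) :
  (forall x, x \in A -> F x <= a) -> (forall x, x \notin A -> F x <= b) ->
  \sum_x F x <= #|A| * a + #|V| * b.
Proof.
move=> Fa Fb; rewrite (bigID (mem A)) /= leq_add //.
  by rewrite -sum_nat_const leq_sum.
apply: (leq_trans (leq_sum _ _)) => [x|]; first exact: Fb.
by rewrite sum_nat_const leq_mul // max_card.
Qed.

Lemma sum_leq_card_in (F : V -> nat) (A : {set V}) (a : nat) :
  (forall x, x \in A -> F x <= a) -> (forall x, x \notin A -> F x = 0) ->
  \sum_x F x <= #|A| * a.
Proof.
move=> Fa F0; have := @sum_leq_card F A a 0 Fa.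
by rewrite muln0 addn0; apply=> x /F0->.
Qed.

Lemma exists_large_term (F : V -> nat) (b : nat) :
  #|V| * b < \sum_x F x -> exists x, b < F x.
Proof.
move=> lt_sum; apply/existsP; apply: contraLR lt_sum => /existsPn leF.
have := @sum_leq_card F set0 0 b.
rewrite -leqNgt cards0 => -> // x; first by rewrite inE.
by move=> _; rewrite leqNgt.
Qed.

Lemma npairsS L L' : (forall x y, L x y -> L' x y) -> npairs L <= npairs L'.
Proof.
move=> LL'; apply: leq_sum => x _; apply: leq_sum => y _.
by move: (LL' x y); case: (L x y) => // ->.
Qed.

Lemma npairsU L L' :
  npairs (fun x y => L x y || L' x y) <= npairs L + npairs L'.
Proof.
rewrite -big_split leq_sum // => x _; rewrite -big_split leq_sum // => y _.
by case: (L x y); case: (L' x y).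
Qed.

Lemma npairs_swap L : npairs (fun x y => L y x) = npairs L.
Proof. exact: exchange_big. Qed.

Lemma npairs_leq L (d : nat) :
  (forall x, #|[set y | L x y]| <= d) -> npairs L <= #|V| * d.
Proof.
move=> leL; rewrite -[leqRHS]add0n -[0](mul0n 0) -(cards0 V).
apply: sum_leq_card => x; first by rewrite inE.
by rewrite sum_indicator.
Qed.

Lemma npairs_leq_in L U (d : nat) :
  (forall x, #|[set y | L x y]| <= d) ->
  npairs (fun x y => (x \in U) && L x y) <= #|U| * d.
Proof.
move=> leL; apply: sum_leq_card_in => x xU.
  by rewrite sum_indicator xU leL.
by rewrite big1 // => y _; rewrite (negPf xU).
Qed.

Lemma ntriplesS T T' :
  (forall x y z, T x y z -> T' x y z) -> ntriples T <= ntriples T'.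
Proof. by move=> TT'; apply: leq_sum => x _; apply: npairsS => y z /TT'. Qed.

Lemma ntriplesU T T' :
  ntriples (fun x y z => T x y z || T' x y z) <= ntriples T + ntriples T'.
Proof. by rewrite -big_split leq_sum // => x _; apply: npairsU. Qed.

Lemma ntriples_swap12 T : ntriples (fun x y z => T y x z) = ntriples T.
Proof. exact: exchange_big. Qed.

Lemma ntriples_swap23 T : ntriples (fun x y z => T x z y) = ntriples T.
Proof. by apply: eq_bigr => x _; apply: npairs_swap. Qed.

Lemma ntriples_rot T : ntriples (fun x y z => T y z x) = ntriples T.
Proof.
by rewrite (ntriples_swap12 (fun x y z => T x z y)) ntriples_swap23.
Qed.

Lemma ntriples_in T U :
  ntriples (fun x y z => (x \in U) && T x y z) = \sum_(x in U) npairs (T x).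
Proof.
rewrite [RHS]big_mkcond; apply: eq_bigr => x _.
by case: (x \in U) => //; rewrite /npairs !big1 // => y _; rewrite big1.
Qed.

Definition star_in L (k : nat) (g : option 'I_k -> V) : Prop :=
  injective g /\ forall j, L (g None) (g (Some j)).

(** By averaging, some vertex outside [U] has more than [k] out-neighbours outside [U].
    Irreflexivity keeps the centre apart from the leaves. *)
Lemma star_exists L (k : nat) U :
  (forall x, ~~ L x x) ->
  #|V| * k < npairs (fun x y => [&& x \notin U, y \notin U & L x y]) ->
  exists g : option 'I_k -> V, star_in L g /\ forall x, g x \notin U.
Proof.
move=> irrL /exists_large_term[x]; rewrite sum_indicator.
set S := [set y | _] => ltS.
have [y] : exists y, y \in S by apply/card_gt0P; apply: leq_ltn_trans ltS.
rewrite inE => /and3P[xU _ _].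
have [|g [g_inj gS]] := @distinct_representatives V 'I_k (fun _ => S).
  by move=> _; rewrite card_ord ltnW.
have {}gS j : (g j \notin U) /\ L x (g j).
  by have := gS j; rewrite inE => /and3P[].
exists (oapp g x); split; last by case=> [j|] //=; case: (gS j).
split; last by move=> j /=; case: (gS j).
have neq j : g j != x.
  by apply: contraNneq (irrL x) => {2}<-; case: (gS j).
case=> [i|] [j|] //= E; first by rewrite (g_inj _ _ E).
  by have := neq i; rewrite E eqxx.
by have := neq j; rewrite E eqxx.
Qed.

Lemma npairs_outside L U (d : nat) :
  (forall x, #|[set y | L x y]| <= d) -> (forall y, #|[set x | L x y]| <= d) ->
  npairs L <=
  npairs (fun x y => [&& x \notin U, y \notin U & L x y]) + #|U| * (2 * d).
Proof.
move=> outd ind.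
pose L1 x y := (x \in U) && L x y; pose L2 x y := (y \in U) && L x y.
have := npairsU L1 L2.
have := npairsU (fun x y => [&& x \notin U, y \notin U & L x y])
                (fun x y => L1 x y || L2 x y).
have le1 : npairs L1 <= #|U| * d by apply: npairs_leq_in.
have le2 : npairs L2 <= #|U| * d.
  by rewrite -npairs_swap; apply: npairs_leq_in.
have : npairs L <= npairs (fun x y =>
    [&& x \notin U, y \notin U & L x y] || (L1 x y || L2 x y)).
  apply: npairsS => x y Lxy; rewrite /L1 /L2 Lxy.
  by case: (x \in U); case: (y \in U).
lia.
Qed.

(** Stars are taken greedily. A vertex lies in at most [2 * d] ordered pairs, so avoiding [U] and
    the earlier stars leaves more than [#|V| * k] pairs, enough for one more star. *)
Lemma star_forest_exists L (h k d : nat) U :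
  (forall x, ~~ L x x) ->
  (forall x, #|[set y | L x y]| <= d) -> (forall y, #|[set x | L x y]| <= d) ->
  (#|U| + h * k.+1) * (2 * d) + #|V| * k < npairs L ->
  exists g : 'I_h -> option 'I_k -> V,
    (forall i, star_in L (g i) /\ forall x, g i x \notin U) /\
    forall i j, i != j -> forall x y, g i x != g j y.
Proof.
move=> irrL outd ind lt_pairs.
apply: (@greedy_disjoint V 'I_h (option 'I_k)
  (fun _ g => star_in L g /\ forall x, g x \notin U) set0 0).
  by move=> *; rewrite setI0 cards0.
move=> i W; rewrite card_ord card_option card_ord => cW _.
have [|g [Lg gU]] := @star_exists L k (U :|: W) irrL; last first.
  exists g; split; last by move=> x; have:= gU x; rewrite inE negb_or => /andP[].
  by split=> // x; have:= gU x; rewrite inE negb_or => /andP[].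
have := npairs_outside (U :|: W) outd ind.
have cUW : #|U :|: W| * (2 * d) <= (#|U| + h * k.+1) * (2 * d).
  rewrite leq_mul2r; apply/orP; right; apply: leq_trans (leq_card_setU _ _) _.
  rewrite leq_add2l; apply: leq_trans cW _.
  by rewrite leq_mul2r leq_pred orbT.
lia.
Qed.

(** The arguments of [T] are apex, star centre and leaf, in this order. As [T] may be asymmetric,
    conditions can be put on one role alone. *)
Definition St3_in T (h k : nat) (f : option ('I_h * option 'I_k) -> V) : Prop :=
  injective f /\
  forall i j, T (f None) (f (Some (i, None))) (f (Some (i, Some j))).

Lemma St3_inS T T' (h k : nat) (f : option ('I_h * option 'I_k) -> V) :
  (forall x y z, T x y z -> T' x y z) -> St3_in T f -> St3_in T' f.
Proof. by move=> TT' [f_inj Tf]; split=> // i j; apply: TT'. Qed.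

Lemma card_St3 (h k : nat) : 0 < h -> 0 < k ->
  #|{: option ('I_h * option 'I_k)}| <= 3 * (h * k).
Proof.
move=> h0 k0; rewrite card_option card_prod card_option !card_ord mulnS.
have : 0 < h * k by rewrite muln_gt0 h0.
by have := leq_pmulr h k0; lia.
Qed.

(** A star forest in a part [L] of the link of [v], made to avoid [v] as well as [U], becomes a copy
    with apex [v]. The term [3 * (h * k)] pays for [v] and for the [h * k.+1] vertices of the
    stars. *)
Lemma St3_in_link T L v (h k d : nat) U :
  0 < h -> 0 < k ->
  (forall x y, L x y -> T v x y) ->
  (forall x, ~~ L x x) ->
  (forall x, #|[set y | L x y]| <= d) -> (forall y, #|[set x | L x y]| <= d) ->
  (#|U| + 3 * (h * k)) * (2 * d) + #|V| * k < npairs L ->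
  exists f : option ('I_h * option 'I_k) -> V,
    [/\ St3_in T f, f None = v & forall x, f (Some x) \notin U].
Proof.
move=> h0 k0 LT irrL outd ind lt_pairs.
have [|g [Lg gg]] := @star_forest_exists L h k d (v |: U) irrL outd ind.
  apply: leq_ltn_trans lt_pairs; rewrite leq_add2r leq_mul2r; apply/orP; right.
  have := card_St3 h0 k0; rewrite card_option card_prod card_option !card_ord.
  have : #|v |: U| <= 1 + #|U| by rewrite cardsU1 leq_add2r leq_b1.
  lia.
have gU i x : (g i x != v) /\ (g i x \notin U).
  have [_ /(_ x)] := Lg i; rewrite !inE negb_or => /andP[]; by split.
exists (fun x => if x is Some p then g p.1 p.2 else v); split=> //; last first.
  by move=> [i x] /=; case: (gU i x).
split; last by move=> i j /=; apply: LT; have [[_ ]] := Lg i.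
case=> [[i x]|] [[j y]|] //= E.
- have ij : i = j by apply/eqP; apply: contraT => /gg/(_ x y); rewrite E eqxx.
  by move: E; rewrite ij => E; have [[g_inj _] _] := Lg j; rewrite (g_inj _ _ E).
- by have [] := gU i x; rewrite E eqxx.
- by have [] := gU j y; rewrite -E eqxx.
Qed.

End Counting.

(** * Disjoint copies when many apexes are available *)

Section Copies.
Variable V : finType.
Implicit Types (T : V -> V -> V -> bool) (U A B : {set V}).

Definition disjoint_St3 T (m h k : nat) : Prop :=
  exists F : 'I_m -> option ('I_h * option 'I_k) -> V,
    (forall i, St3_in T (F i)) /\
    forall i j, i != j -> forall x y, F i x != F j y.

Lemma disjoint_St3S T T' (m h k : nat) :
  (forall x y z, T x y z -> T' x y z) ->
  disjoint_St3 T m h k -> disjoint_St3 T' m h k.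
Proof.
by move=> TT' [F [FT FF]]; exists F; split=> // i; apply: St3_inS (FT i).
Qed.

Definition codegree T x y := #|[set z | T x y z]|.

Lemma card_minus_imset (I : finType) (f : I -> V) A (a : nat) :
  a + #|I| <= #|A| -> a <= #|A :\: f @: I|.
Proof.
rewrite cardsD => leA; have : #|A :&: f @: I| <= #|I|.
  exact: leq_trans (subset_leq_card (subsetIr _ _)) (leq_imset_card _ _).
by have := subset_leq_card (subsetIl A (f @: I)); lia.
Qed.

(** All apexes are chosen first, then all centres, then all leaves, each time as distinct
    representatives. Centres must avoid [m] apexes, and [m + m * h <= 2 * (m * h)]; leaves must
    avoid apexes and centres, and [m + m * h + m * h * k <= 3 * (m * h * k)]. *)
Lemma disjoint_St3_rich T (m h k : nat) A :
  0 < m -> 0 < h -> 0 < k -> m <= #|A| ->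
  (forall v, v \in A ->
     2 * (m * h) <= #|[set u | 3 * (m * h * k) <= codegree T v u]|) ->
  disjoint_St3 T m h k.
Proof.
move=> m0 h0 k0 leA rich.
have mh : m <= m * h by rewrite leq_pmulr.
have mhk : m * h <= m * h * k by rewrite leq_pmulr.
have [|a [a_inj aA]] := @distinct_representatives V 'I_m (fun _ => A).
  by rewrite card_ord.
pose H v := [set u | 3 * (m * h * k) <= codegree T v u].
have [|c [c_inj cH]] := @distinct_representatives V ('I_m * 'I_h)%type
    (fun p => H (a p.1) :\: a @: 'I_m).
  case=> i j; rewrite card_prod !card_ord; apply: card_minus_imset.
  by rewrite card_ord; apply: leq_trans (rich _ (aA i)); lia.
have [|l [l_inj lN]] := @distinct_representatives V ('I_m * 'I_h * 'I_k)%type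
  (fun p => [set w | T (a p.1.1) (c p.1) w] :\: a @: 'I_m
             :\: c @: {: 'I_m * 'I_h}).
  case=> p j; rewrite !card_prod !card_ord.
  do 2 (apply: card_minus_imset; rewrite ?card_prod ?card_ord).
  have := cH p; rewrite inE => /andP[_]; rewrite inE /codegree /=; lia.
pose F i x := match x with
  | None => a i | Some (j, None) => c (i, j)
  | Some (j, Some r) => l (i, j, r) end.
have ca p i : c p <> a i.
  by move=> E; have := cH p; rewrite E inE imset_f.
have la p i : l p <> a i.
  by move=> E; have := lN p; rewrite E !inE imset_f ?andbF.
have lc p q : l p <> c q.
  by move=> E; have := lN p; rewrite E inE imset_f.
have F_inj i j x y : F i x = F j y -> i = j /\ x = y.
  case: x y => [[r [s|]]|] [[r' [s'|]]|] /= E.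
  - by case: (l_inj _ _ E) => -> -> ->.
  - by case: (lc _ _ E).
  - by case: (la _ _ E).
  - by case: (lc _ _ (esym E)).
  - by case: (c_inj _ _ E) => -> ->.
  - by case: (ca _ _ E).
  - by case: (la _ _ (esym E)).
  - by case: (ca _ _ (esym E)).
  - by rewrite (a_inj _ _ E).
exists F; split=> [i|i j ij x y]; last first.
  by apply: contra ij => /eqP/F_inj[->].
split=> [x y /F_inj[]//|j r /=].
by have := lN (i, j, r); rewrite !inE => /and3P[].
Qed.

(** These two transpositions generate all permutations of the arguments. *)
Definition symmetric3 T :=
  (forall x y z, T x y z = T y x z) /\ (forall x y z, T x y z = T x z y).

Definition irreflexive3 T := forall x y, ~~ T x y y.

Lemma indegree_codegree T x z : symmetric3 T ->
  #|[set y | T x y z]| = codegree T x z.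
Proof. by case=> _ T23; apply: eq_card => y; rewrite !inE T23. Qed.

Lemma npairs_avoid L U :
  npairs L <= npairs (fun x y => [&& L x y, x \notin U & y \notin U])
              + 2 * (#|U| * #|V|).
Proof.
pose L1 x y := (x \in U) && L x y; pose L2 x y := (y \in U) && L x y.
have le1 : npairs L1 <= #|U| * #|V|.
  by apply: npairs_leq_in => x; apply: max_card.
have le2 : npairs L2 <= #|U| * #|V|.
  rewrite -npairs_swap; apply: (@npairs_leq_in _ (fun x y => L y x)) => x.
  exact: max_card.
have := npairsU L1 L2.
have := npairsU (fun x y => [&& L x y, x \notin U & y \notin U])
                (fun x y => L1 x y || L2 x y).
have : npairs L <= npairs (fun x y =>
    [&& L x y, x \notin U & y \notin U] || (L1 x y || L2 x y)).
  apply: npairsS => x y Lxy; rewrite /L1 /L2 Lxy.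
  by case: (x \in U); case: (y \in U).
lia.
Qed.

(** Either [m] vertices of [A] are rich in the sense of [disjoint_St3_rich], or at least [2 * m] are
    not. The link of such a [v] has fewer than [2 * (m * h)] vertices of large degree; deleting
    these costs at most [4 * (m * h * #|V|)] pairs and leaves degrees at most [3 * (m * h * k)], so
    that star forests can be found greedily. *)
Lemma disjoint_St3_many_apexes T (m h k : nat) A :
  0 < m -> 0 < h -> 0 < k -> symmetric3 T -> irreflexive3 T ->
  3 * m <= #|A| ->
  (forall v, v \in A ->
     4 * (m * h * #|V|) + 48 * (m * h * k) ^ 2 + #|V| * k < npairs (T v)) ->
  disjoint_St3 T m h k.
Proof.
move=> m0 h0 k0 symT irrT leA high.
have mh : m <= m * h by rewrite leq_pmulr.
have mhk : m * h <= m * h * k by rewrite leq_pmulr.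
have hk : h * k <= m * h * k by rewrite -mulnA leq_pmull.
pose H v := [set u | 3 * (m * h * k) <= codegree T v u].
pose A1 := [set v in A | 2 * (m * h) <= #|H v|].
have [leA1|ltA1] := leqP m #|A1|.
  by apply: (disjoint_St3_rich m0 h0 k0 leA1) => v; rewrite inE => /andP[].
(* The apexes are confined to a set [A2] of size exactly [2 * m], which the *)
(* other vertices of the copies can afford to avoid.                         *)
have /card_geqP[s [us size_s sA]] : 2 * m <= #|A :\: A1|.
  rewrite cardsD; have : #|A :&: A1| <= #|A1|.
    exact: subset_leq_card (subsetIr _ _).
  lia.
pose A2 := [set x in s].
have cA2 : #|A2| = 2 * m by rewrite cardsE (card_uniqP us).
pose P (f : option ('I_h * option 'I_k) -> V) :=
  [/\ St3_in T f, f None \in A2 & forall x, f (Some x) \notin A2].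
(* Each copy meets [A2] in its apex only, so at most [m - 1] of the [2 * m] candidates are used up
   and a fresh apex always remains. *)
have [||F [FP FF]] := @greedy_disjoint V 'I_m _ (fun _ => P) A2 1; last first.
  by exists F; split=> // i; case: (FP i).
- move=> i U cU cUA.
  have {cUA} /subsetPn[v vA2 vU] : ~~ (A2 \subset U).
    apply/negP => /setIidPr E; move: cUA; rewrite E cA2 card_ord; lia.
  have : v \in A :\: A1 by apply: sA; move: vA2; rewrite inE.
  rewrite !inE => /andP[vA1 vA]; rewrite vA /= -ltnNge in vA1.
  pose L u w := [&& T v u w, u \notin H v & w \notin H v].
  have [|||||f [fT fv fU]] :=
      @St3_in_link V T L v h k (3 * (m * h * k)) (A2 :|: U) h0 k0.
  + by move=> x y /and3P[].
  + by move=> x; rewrite /L (negPf (irrT v x)).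
  + move=> x; case: (boolP (x \in H v)) => [xH|].
      suff -> : [set y | L x y] = set0 by rewrite cards0.
      by apply/setP => y; rewrite !inE /L xH andbF.
    rewrite inE -ltnNge => /ltnW; apply: leq_trans.
    by apply: subset_leq_card; apply/subsetP => y; rewrite !inE => /and3P[].
  + move=> y; case: (boolP (y \in H v)) => [yH|].
      suff -> : [set x | L x y] = set0 by rewrite cards0.
      by apply/setP => x; rewrite !inE /L yH !andbF.
    rewrite inE -ltnNge -indegree_codegree // => /ltnW; apply: leq_trans.
    by apply: subset_leq_card; apply/subsetP => x; rewrite !inE => /and3P[].
  + have := npairs_avoid (T v) (H v); rewrite -/L => leL.
    have := high v vA.
    have : #|H v| * #|V| <= 2 * (m * h) * #|V| by rewrite leq_mul2r ltnW ?orbT.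
    have : #|A2 :|: U| <= 2 * m + 3 * (m * h * k).
      apply: leq_trans (leq_card_setU _ _) _; rewrite cA2 leq_add2l.
      apply: leq_trans cU _; rewrite card_ord.
      apply: leq_trans (leq_mul (leq_pred _) (card_St3 h0 k0)) _.
      by rewrite mulnCA !mulnA.
    (* The first factor is at most [2 * m + 3 * (m * h * k) + 3 * (h * k)], which explains the 8 and
       then 48 as 8 times 6. *)
    move=> c1; have : (#|A2 :|: U| + 3 * (h * k)) * (2 * (3 * (m * h * k)))
      <= (8 * (m * h * k)) * (6 * (m * h * k)) by apply: leq_mul; lia.
    have -> : (8 * (m * h * k)) * (6 * (m * h * k)) = 48 * (m * h * k) ^ 2.
      by rewrite mulnACA -mulnn.
    have -> : 2 * (m * h) * #|V| = 2 * (m * h * #|V|) by rewrite -mulnA.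
    lia.
  exists f; split; last first.
    case=> [x|]; last by rewrite fv.
    by have := fU x; rewrite inE negb_or => /andP[].
  split=> //; first by rewrite fv.
  by move=> x; have := fU x; rewrite inE negb_or => /andP[].
- move=> i f [_ fA2 fNA2]; rewrite -(cards1 (f None)); apply: subset_leq_card.
  apply/subsetP => y; rewrite !inE => /andP[/imsetP[[x|] _ ->] //].
  by have := fNA2 x; rewrite inE => /negPf->.
Qed.

End Copies.

(** * Triple systems in which every vertex has low degree *)

Section LowDegree.
Variable V : finType.
Implicit Types (T : V -> V -> V -> bool) (U A B : {set V}).

(** Since [h] and [k] are positive, every vertex of a copy lies in one of its edges. *)
Lemma St3_avoids T (h k : nat) U (f : option ('I_h * option 'I_k) -> V) :
  0 < h -> 0 < k -> St3_in T f ->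
  (forall x y z, T x y z -> [/\ x \notin U, y \notin U & z \notin U]) ->
  forall x, f x \notin U.
Proof.
move=> h0 k0 [_ Tf] TU [[i [j|]]|].
- by case: (TU _ _ _ (Tf i j)).
- by case: (TU _ _ _ (Tf i (Ordinal k0))).
- by case: (TU _ _ _ (Tf (Ordinal h0) (Ordinal k0))).
Qed.

Definition avoid T U x y z := [&& T x y z, x \notin U, y \notin U & z \notin U].

Lemma avoidP T U x y z :
  avoid T U x y z -> [/\ x \notin U, y \notin U & z \notin U].
Proof. by case/and4P. Qed.

Lemma ntriples_avoid T U :
  ntriples T <= ntriples (avoid T U)
    + ntriples (fun x y z => (x \in U) && T x y z)
    + ntriples (fun x y z => (y \in U) && T x y z)
    + ntriples (fun x y z => (z \in U) && T x y z).
Proof.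
pose S x y z := ((avoid T U x y z || (x \in U) && T x y z)
  || (y \in U) && T x y z) || (z \in U) && T x y z.
apply: (@leq_trans (ntriples S)).
  apply: ntriplesS => x y z; rewrite /S /avoid => ->.
  by case: (x \in U); case: (y \in U); case: (z \in U).
by do 2 (apply: leq_trans (ntriplesU _ _) _; rewrite leq_add2r);
   apply: ntriplesU.
Qed.

Lemma ntriples_avoid_sym T U : symmetric3 T ->
  ntriples T <= ntriples (avoid T U) + 3 * \sum_(x in U) npairs (T x).
Proof.
case=> T12 T23; rewrite -ntriples_in.
have E2 : ntriples (fun x y z => (y \in U) && T x y z)
        = ntriples (fun x y z => (x \in U) && T x y z).
  rewrite -ntriples_swap12; apply: eq_bigr => x _; apply: eq_bigr => y _.
  by apply: eq_bigr => z _; rewrite T12.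
have E3 : ntriples (fun x y z => (z \in U) && T x y z)
        = ntriples (fun x y z => (x \in U) && T x y z).
  rewrite -ntriples_rot.
  apply: eq_bigr => x _; apply: eq_bigr => y _.
  by apply: eq_bigr => z _; rewrite /= T23 T12.
have := ntriples_avoid T U; rewrite E2 E3; lia.
Qed.

Lemma avoid_symmetric3 T U : symmetric3 T -> symmetric3 (avoid T U).
Proof.
case=> T12 T23; split=> x y z; rewrite /avoid.
  by rewrite T12; congr (_ && _); rewrite andbCA.
by rewrite T23; congr (_ && (_ && _)); rewrite andbC.
Qed.

Lemma avoid_irreflexive3 T U : irreflexive3 T -> irreflexive3 (avoid T U).
Proof. by move=> irrT x y; rewrite /avoid (negPf (irrT x y)). Qed.

(** Apex and centres may lie in [B], so a copy in this relation has at most [h.+1] vertices in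
    [B]. *)
Definition leaf_outside T B x y z := T x y z && (z \notin B).

Definition heavy_pair T B (c : nat) x y := c <= codegree (leaf_outside T B) x y.

Lemma heavy_pair_sym T B c x y :
  symmetric3 T -> heavy_pair T B c x y = heavy_pair T B c y x.
Proof.
case=> T12 _; rewrite /heavy_pair; congr (_ <= _).
by apply: eq_card => z; rewrite !inE /leaf_outside T12.
Qed.

Section NoCopyLeafOutside.
Variables (T : V -> V -> V -> bool) (B : {set V}) (h k : nat).
Hypotheses (h0 : 0 < h) (k0 : 0 < k) (symT : symmetric3 T).
Hypothesis irrT : irreflexive3 T.
Hypothesis no_copy : forall f : option ('I_h * option 'I_k) -> V,
  ~ St3_in (leaf_outside T B) f.

Local Notation heavy := (heavy_pair T B (3 * (h * k))).

(** Otherwise [v] is a rich apex, and [disjoint_St3_rich] with a single copy contradicts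
    [no_copy]. *)
Lemma few_heavy_pairs v : #|[set u | heavy v u]| < 2 * h.
Proof.
rewrite ltnNge; apply/negP => le_heavy.
have [|u|F [FT _]] :=
  @disjoint_St3_rich V (leaf_outside T B) 1 h k [set v] isT h0 k0.
- by rewrite cards1.
- by rewrite inE => /eqP->; rewrite !mul1n.
exact: no_copy (FT ord0).
Qed.

(** Up to rotation a triple lies inside [B] ([T0]), has a light pair in [B] and its third vertex
    outside ([T1]), has a heavy pair and its third vertex outside ([T2]), or has two vertices
    outside [B] that both form light pairs with the third ([T3]). The links of [T3] at its third
    vertex have degrees at most [3 * (h * k)], so a link with more than
    [18 * (h * k) ^ 2 + #|V| * k] pairs would contain a forbidden copy. *)
Lemma ntriples_le_heavy :
  ntriples T <= #|B| ^ 3 + 9 * (#|B| ^ 2 * (h * k))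
    + 3 * (#|V| * (18 * (h * k) ^ 2 + #|V| * k))
    + 3 * ntriples (fun x y z => heavy x y && leaf_outside T B x y z).
Proof.
have [T12 T23] := symT.
pose T0 x y z := [&& T x y z, x \in B, y \in B & z \in B].
pose T1 x y z := [&& x \in B, y \in B, ~~ heavy x y & leaf_outside T B x y z].
pose T2 x y z := heavy x y && leaf_outside T B x y z.
pose T3 x y z :=
  [&& T x y z, x \notin B, y \notin B, ~~ heavy z x & ~~ heavy y z].
pose S x y z := T1 x y z || T2 x y z || T3 x y z.
have leS : ntriples S <= ntriples T1 + ntriples T2 + ntriples T3.
  have := ntriplesU (fun x y z => T1 x y z || T2 x y z) T3.
  have := ntriplesU T1 T2; rewrite -/S; lia.
have leT : ntriples T <= ntriples T0 + 3 * ntriples S.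
  have : ntriples T <= ntriples (fun x y z =>
      ((T0 x y z || S x y z) || S y z x) || S z x y).
    apply: ntriplesS => x y z Txyz; rewrite /T0 /S /T1 /T2 /T3 /leaf_outside.
    have -> : T y z x by rewrite T23 T12.
    have -> : T z x y by rewrite T12 T23.
    rewrite Txyz; case: (x \in B); case: (y \in B); case: (z \in B);
    by case: (heavy x y); case: (heavy y z); case: (heavy z x).
  have := ntriplesU (fun x y z => (T0 x y z || S x y z) || S y z x)
                    (fun x y z => S z x y).
  have := ntriplesU (fun x y z => T0 x y z || S x y z) (fun x y z => S y z x).
  have := ntriplesU T0 S.
  have := ntriples_rot S; have := ntriples_rot (fun x y z => S y z x); lia.
have le0 : ntriples T0 <= #|B| ^ 3.
  rewrite expnS.
  apply: sum_leq_card_in => x xB; last first.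
    by rewrite /npairs big1 // => y _; rewrite big1 // => z _;
       rewrite /T0 (negPf xB) andbF.
  rewrite -mulnn.
  apply: sum_leq_card_in => y yB; last first.
    by rewrite big1 // => z _; rewrite /T0 (negPf yB) !andbF.
  rewrite sum_indicator; apply: subset_leq_card.
  by apply/subsetP => z; rewrite inE => /and4P[].
have le1 : ntriples T1 <= 3 * (#|B| ^ 2 * (h * k)).
  rewrite mulnCA -mulnn -mulnA.
  apply: sum_leq_card_in => x xB; last first.
    by rewrite /npairs big1 // => y _; rewrite big1 // => z _;
       rewrite /T1 (negPf xB).
  apply: sum_leq_card_in => y yB; last first.
    by rewrite big1 // => z _; rewrite /T1 (negPf yB) !andbF.
  rewrite sum_indicator; have [hxy|] := boolP (heavy x y).
    suff -> : [set z | T1 x y z] = set0 by rewrite cards0.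
    by apply/setP => z; rewrite !inE /T1 hxy !andbF.
  rewrite -ltnNge => /ltnW; apply: leq_trans; apply: subset_leq_card.
  by apply/subsetP => z; rewrite !inE => /and4P[].
have le3 : ntriples T3 <= #|V| * (18 * (h * k) ^ 2 + #|V| * k).
  rewrite leqNgt -ntriples_rot.
  apply/negP => /exists_large_term[v lt_v].
  have [|||||f [fT _ _]] := @St3_in_link V (fun z x y => T3 x y z)
    (fun x y => T3 x y v) v h k (3 * (h * k)) set0 h0 k0 => //.
  - by move=> x; rewrite /T3 T23 T12 (negPf (irrT _ _)).
  - move=> x; have [hx|] := boolP (heavy v x).
      suff -> : [set y | T3 x y v] = set0 by rewrite cards0.
      by apply/setP => y; rewrite !inE /T3 hx !andbF.
    rewrite -ltnNge => /ltnW; apply: leq_trans; apply: subset_leq_card.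
    apply/subsetP => y; rewrite !inE /leaf_outside => /and5P[Txyv _ -> _ _].
    by rewrite T12 T23 Txyv.
  - move=> y; have [hy|] := boolP (heavy y v).
      suff -> : [set x | T3 x y v] = set0 by rewrite cards0.
      by apply/setP => x; rewrite !inE /T3 hy !andbF.
    rewrite -ltnNge => /ltnW; apply: leq_trans; apply: subset_leq_card.
    apply/subsetP => x; rewrite !inE /leaf_outside => /and5P[Txyv -> _ _ _].
    by rewrite T23 T12 Txyv.
  - move: lt_v; rewrite cards0 add0n; apply: leq_ltn_trans.
    by rewrite leq_add2r -mulnn; lia.
  apply: no_copy; apply: St3_inS fT => z x y /and5P[Txyz _ yB _ _].
  by rewrite /leaf_outside T12 T23 Txyz.
rewrite -/T2; lia.
Qed.

End NoCopyLeafOutside.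

(* The third vertex of a heavy triple is the apex here, so that the stars    *)
(* live in the graph of heavy pairs, whose degrees are at most [2 * h].       *)
Lemma disjoint_St3_heavy T (H : V -> V -> bool) B (m h k N : nat) :
  0 < m -> 0 < h -> 0 < k -> 0 < N -> symmetric3 T -> irreflexive3 T ->
  (forall x y, H x y = H y x) ->
  (forall x, #|[set y | H x y]| <= 2 * h) ->
  (forall x, x \notin B -> npairs (T x) * (90 * (m * h * k)) <= N) ->
  1000 * (m ^ 2 * h ^ 2 * #|V|) <= N ->
  1000 * (h ^ 2 * k ^ 2 * #|V|) <= N ->
  1000 * (#|V| ^ 2 * k) <= N ->
  N <= 10 * ntriples (fun x y z => H x y && leaf_outside T B x y z) ->
  disjoint_St3 T m h k.
Proof.
move=> m0 h0 k0 N0 symT irrT symH leH lowT le_mh le_hk le_k leN.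
have [T12 T23] := symT.
pose TH x y z := H x y && leaf_outside T B x y z.
have [||F [FT FF]] := @greedy_disjoint V 'I_m _
    (fun _ (f : option ('I_h * option 'I_k) -> V) => St3_in T f) set0 0.
- by move=> *; rewrite setI0 cards0.
- move=> i U cU _.
  have {}cU : #|U| <= 3 * (m * h * k).
    apply: leq_trans cU _; rewrite card_ord.
    apply: leq_trans (leq_mul (leq_pred _) (card_St3 h0 k0)) _.
    by rewrite mulnCA !mulnA.
  have le1 : ntriples (fun x y z => (x \in U) && TH x y z)
      <= 6 * (m * h ^ 2 * k * #|V|).
    rewrite ntriples_in; apply: (@leq_trans (\sum_(x in U) 2 * h * #|V|)).
      apply: leq_sum => x _; 
      apply: leq_trans (leq_mul (leH x) (leqnn _)).
      apply: sum_leq_card_in => y; rewrite inE => Hxy.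
        by rewrite sum_indicator max_card.
      by rewrite big1 // => z _; rewrite /TH (negPf Hxy).
    rewrite sum_nat_const; apply: leq_trans (leq_mul cU (leqnn _)) _.
    by rewrite -!mulnn; lia.
  have le2 : ntriples (fun x y z => (y \in U) && TH x y z)
      <= 6 * (m * h ^ 2 * k * #|V|).
    rewrite -ntriples_swap12; apply: leq_trans le1; apply: ntriplesS => x y z.
    by rewrite /TH /leaf_outside symH T12.
  (* Third vertices lie outside [B], hence have degree at most [N / (90 * m * h * k)], and [U] has
     at most [3 * (m * h * k)] vertices. *)
  have le3 : 30 * ntriples (fun x y z => (z \in U) && TH x y z) <= N.
    rewrite -ntriples_rot.
    rewrite (ntriples_in (fun z x y => TH x y z)).
    rewrite -(@leq_pmul2l (3 * (m * h * k))) ?muln_gt0 ?m0 ?h0 ?k0 //.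
    apply: (@leq_trans (#|U| * N)); last by rewrite leq_mul2r cU orbT.
    rewrite mulnCA mulnA mulnC big_distrl -sum_nat_const; apply: leq_sum => z _.
    have [zB|zB] := boolP (z \in B).
      rewrite /npairs big1 // => x _; rewrite big1 // => y _.
      by rewrite /TH /leaf_outside zB !andbF.
    apply: leq_trans (lowT z zB); rewrite mulnA leq_mul2r; apply/orP; right.
    by apply: npairsS => x y /and3P[_]; rewrite T23 T12.
  (* The mixed term is the product of [m * h] and [h * k], so the inequality between arithmetic and
     geometric means reduces it to the two assumed bounds. *)
  have leAM : 2 * (m * h ^ 2 * k * #|V|)
      <= m ^ 2 * h ^ 2 * #|V| + h ^ 2 * k ^ 2 * #|V|.
    rewrite -mulnDl mulnA leq_mul2r; apply/orP; right.
    have [] := nat_Cauchy (m * h) (h * k); rewrite !expnMn -!mulnn; lia.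
  have h2k : h ^ 2 * k * #|V| <= h ^ 2 * k ^ 2 * #|V|.
    rewrite leq_mul2r leq_mul2l; apply/orP; right; apply/orP; right.
    by rewrite -mulnn leq_pmulr.
  (* The apex [w] comes from averaging. The term [12 * (h ^ 2 * k)] is [3 * (h * k)] times
     [2 * (2 * h)], the greedy cost in a graph of maximum degree [2 * h]. *)
  have [w ltw] : exists w, 12 * (h ^ 2 * k) + #|V| * k
      < npairs (fun x y => avoid TH U x y w).
    apply: exists_large_term.
    have -> : \sum_w npairs (fun x y => avoid TH U x y w) = ntriples (avoid TH U).
      by rewrite -[RHS]ntriples_rot.
    have := ntriples_avoid TH U.
    have -> : #|V| * (12 * (h ^ 2 * k) + #|V| * k)
      = 12 * (h ^ 2 * k * #|V|) + #|V| ^ 2 * k by rewrite -!mulnn; lia.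
    rewrite -/TH in leN; lia.
  have [|||||f [fT _ _]] := @St3_in_link V (fun z x y => avoid TH U x y z)
    (fun x y => avoid TH U x y w) w h k (2 * h) set0 h0 k0 => //.
  + move=> x; rewrite /avoid /TH /leaf_outside T23 T12.
    by rewrite (negPf (irrT w x)) !andbF.
  + move=> x; apply: leq_trans (leH x); apply: subset_leq_card.
    by apply/subsetP => y; rewrite !inE => /andP[/andP[]].
  + move=> y; apply: leq_trans (leH y); apply: subset_leq_card.
    by apply/subsetP => x; rewrite !inE symH => /andP[/andP[]].
  + move: ltw; rewrite cards0 add0n; apply: leq_ltn_trans.
    by rewrite leq_add2r -mulnn; lia.
  exists f; split; last first.
    by apply: (St3_avoids h0 k0 fT) => x y z /avoidP[].
  apply: St3_inS fT => z x y /and4P[/and3P[_]].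
  by rewrite T23 T12.
by exists F; split=> // i; apply: FT.
Qed.

(** Copies with leaves outside [B] are taken greedily. If this gets stuck, what avoids the used
    vertices has no such copy, hence many heavy triples, and [disjoint_St3_heavy] builds all [m]
    copies afresh. *)
Lemma disjoint_St3_low_degree T (m h k : nat) :
  0 < m -> 0 < h -> 0 < k -> 0 < ntriples T ->
  symmetric3 T -> irreflexive3 T ->
  (forall x, npairs (T x) * (60 * (m * h)) <= ntriples T) ->
  10 * (90 * (m * h * k)) ^ 3 <= ntriples T ->
  1000 * (m ^ 2 * h ^ 2 * #|V|) <= ntriples T ->
  1000 * (h ^ 2 * k ^ 2 * #|V|) <= ntriples T ->
  1000 * (#|V| ^ 2 * k) <= ntriples T ->
  disjoint_St3 T m h k.
Proof.
set N := ntriples T => m0 h0 k0 N0 symT irrT lowT le_x le_mh le_hk le_k.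
have mh0 : 0 < m * h by rewrite muln_gt0 m0.
have x0 : 0 < m * h * k by rewrite muln_gt0 mh0.
pose B := [set x | N < npairs (T x) * (90 * (m * h * k))].
have lowB x : x \notin B -> npairs (T x) * (90 * (m * h * k)) <= N.
  by rewrite inE -leqNgt.
have cB : #|B| <= 90 * (m * h * k).
  rewrite -(leq_pmul2r N0) -sum_nat_const.
  apply: (@leq_trans (\sum_(x in B) npairs (T x) * (90 * (m * h * k)))).
    by apply: leq_sum => x; rewrite inE => /ltnW.
  rewrite -big_distrl [leqRHS]mulnC leq_mul2r /=; apply/orP; right.
  by rewrite [leqRHS](bigID (mem B)) leq_addr.
(* Being stuck also produces the wanted copies, only by another route. Arguing by contradiction thus
   lets every greedy step be assumed to succeed. *)
apply: contrapT => noT.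
have [|i U cU cUB|F [FP FF]] := @greedy_disjoint V 'I_m _
    (fun _ (f : option ('I_h * option 'I_k) -> V) =>
       St3_in (leaf_outside T B) f) B h.+1.
- move=> i f [_ fT].
  pose g (o : option 'I_h) := f (if o is Some r then Some (r, None) else None).
  have : #|[set g o | o : option 'I_h]| <= h.+1.
    by apply: leq_trans (leq_imset_card _ _) _; rewrite card_option card_ord.
  apply: leq_trans; apply: subset_leq_card; apply/subsetP => y.
  rewrite inE => /andP[/imsetP[[[r [s|]]|] _ ->] yB]; apply/imsetP.
  + by have := fT r s; rewrite /leaf_outside yB andbF.
  + by exists (Some r).
  + by exists None.
- have {}cU : #|U| <= 3 * (m * h * k).
    apply: leq_trans cU _; rewrite card_ord.
    apply: leq_trans (leq_mul (leq_pred _) (card_St3 h0 k0)) _.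
    by rewrite mulnCA !mulnA.
  have {}cUB : #|U :&: B| <= 2 * (m * h).
    apply: leq_trans cUB _; rewrite card_ord mulnCA leq_mul ?leq_pred //.
    by rewrite mul2n -addnn -addn1 leq_add2l.
  apply: contrapT => noU; apply: noT.
  have le1 : 30 * \sum_(x in U :&: B) npairs (T x) <= N.
    rewrite -(@leq_pmul2l (2 * (m * h))) ?muln_gt0 ?m0 ?h0 //.
    apply: (@leq_trans (#|U :&: B| * N)); last by rewrite leq_mul2r cUB orbT.
    rewrite mulnCA mulnA mulnC big_distrl -sum_nat_const; apply: leq_sum => x _.
    by rewrite mulnA; apply: lowT.
  have le2 : 30 * \sum_(x in U :\: B) npairs (T x) <= N.
    rewrite -(@leq_pmul2l (3 * (m * h * k))) ?muln_gt0 ?m0 ?h0 ?k0 //.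
    apply: (@leq_trans (#|U| * N)); last by rewrite leq_mul2r cU orbT.
    rewrite mulnCA mulnA mulnC big_distrl.
    apply: (@leq_trans (\sum_(x in U :\: B) N)).
      apply: leq_sum => x; rewrite inE => /andP[/lowB lex _].
      by rewrite mulnA.
    by rewrite sum_nat_const leq_mul2r subset_leq_card ?orbT ?subsetDl.
  have leU := ntriples_avoid_sym U symT.
  rewrite (big_setID B) /= in leU.
  have symU := avoid_symmetric3 U symT.
  have irrU := avoid_irreflexive3 U irrT.
  have no_copy (f : option ('I_h * option 'I_k) -> V) :
      ~ St3_in (leaf_outside (avoid T U) B) f.
    move=> fU; apply: noU; exists f; split.
      apply: St3_inS fU => x y z; rewrite /leaf_outside.
      by case/andP=> /andP[-> _] ->.
    by apply: (St3_avoids h0 k0 fU) => x y z /andP[/avoidP].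
  apply: (@disjoint_St3S _ (avoid T U)); first by move=> x y z /andP[].
  apply: (@disjoint_St3_heavy _ (heavy_pair (avoid T U) B (3 * (h * k)))
            B _ _ _ N) => //.
  + by move=> x y; apply: heavy_pair_sym.
  + by move=> x; apply/ltnW/few_heavy_pairs.
  + move=> x /lowB; apply: leq_trans; rewrite leq_mul2r; apply/orP; right.
    by apply: npairsS => y z /andP[].
  (* The used vertices in [B] and those outside have total degree at most [N / 30] each, so at least
     [4 * N / 5] triples survive. The terms without heavy pairs take less than [N / 5] of these, and
     a third of the rest exceeds [N / 10]. *)
  have := ntriples_le_heavy h0 k0 symU irrU no_copy.
  have B3 : #|B| ^ 3 <= (90 * (m * h * k)) ^ 3 by rewrite leq_exp2r.
  have B2 : 90 * (#|B| ^ 2 * (h * k)) <= (90 * (m * h * k)) ^ 3.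
    rewrite [leqRHS]expnSr mulnCA; apply: leq_mul; first by rewrite leq_exp2r.
    by rewrite leq_mul2l -mulnA leq_pmull.
  have -> : #|V| * (18 * (h * k) ^ 2 + #|V| * k)
      = 18 * (h ^ 2 * k ^ 2 * #|V|) + #|V| ^ 2 * k.
    by rewrite expnMn -!mulnn; lia.
  lia.
- by apply: noT; exists F; split=> // i; apply: St3_inS (FP i) => x y z /andP[].
Qed.

End LowDegree.

(** * Joining the two cases, and passing from triples to edges *)

Section ThreeGraphs.
Variable V : finType.

Lemma ntriples_leq (T : V -> V -> V -> bool) : ntriples T <= #|V| ^ 3.
Proof.
rewrite expnS -cardsT; apply: sum_leq_card_in => x; last by rewrite inE.
rewrite cardsT -mulnn => _; rewrite /npairs -cardsT.
apply: sum_leq_card_in => y; last by rewrite inE.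
by rewrite sum_indicator cardsT max_card.
Qed.

(** If fewer than [3 * m] vertices have large degree, deleting them costs at most
    [9 * (#|V| ^ 2 * m)] triples, less than half of all. This halving turns 120 into 60 in the
    degree bound and accounts for 20 and 2000 in place of 10 and 1000. *)
Lemma disjoint_St3_of_ntriples (T : V -> V -> V -> bool) (m h k : nat) :
  0 < m -> 0 < h -> 0 < k -> 0 < ntriples T ->
  symmetric3 T -> irreflexive3 T ->
  20 * (90 * (m * h * k)) ^ 3 <= ntriples T ->
  2000 * (m ^ 2 * h ^ 2 * #|V|) <= ntriples T ->
  2000 * (h ^ 2 * k ^ 2 * #|V|) <= ntriples T ->
  2000 * (#|V| ^ 2 * k) <= ntriples T ->
  2000 * (#|V| ^ 2 * m) <= ntriples T ->
  disjoint_St3 T m h k.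
Proof.
move=> m0 h0 k0; set N := ntriples T => N0 symT irrT le_x le_mh le_hk le_k le_m.
have V0 : 0 < #|V|.
  rewrite lt0n; apply: contraTneq N0 => V0; rewrite -leqNgt leqn0.
  by apply/eqP; rewrite /N /ntriples big1 // => x; case: (fintype0 x V0).
have mh0 : 0 < m * h by rewrite muln_gt0 m0.
(* This follows from [m ^ 2 * h ^ 2 * #|V| <= N <= #|V| ^ 3]. *)
have le_mhV : m * h <= #|V|.
  rewrite -leq_sqr expnMn -(leq_pmul2r V0) -expnSr.
  by apply: leq_trans (ntriples_leq T); rewrite -/N; lia.
pose A := [set v | N < npairs (T v) * (120 * (m * h))].
have [leA|ltA] := leqP (3 * m) #|A|.
  apply: (disjoint_St3_many_apexes m0 h0 k0 symT irrT leA) => v.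
  rewrite inE => ltN; rewrite -(@ltn_pmul2r (120 * (m * h))) ?muln_gt0 ?m0 //.
  apply: leq_ltn_trans ltN.
  have le1 : (m * h * k) ^ 2 * (m * h) <= (m * h * k) ^ 3.
    by rewrite [leqRHS]expnSr leq_mul2l leq_pmulr ?orbT.
  have le2 : #|V| * k * (m * h) <= #|V| ^ 2 * k.
    by rewrite mulnAC leq_mul2r -mulnn leq_mul2l le_mhV !orbT.
  have -> : (4 * (m * h * #|V|) + 48 * (m * h * k) ^ 2 + #|V| * k)
      * (120 * (m * h)) = 480 * (m ^ 2 * h ^ 2 * #|V|)
      + 120 * (48 * ((m * h * k) ^ 2 * (m * h))) + 120 * (#|V| * k * (m * h)).
    by rewrite -!mulnn; lia.
  rewrite expnMn in le_x; lia.
have le_loss : \sum_(x in A) npairs (T x) <= 3 * (#|V| ^ 2 * m).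
  apply: (@leq_trans (\sum_(x in A) #|V| ^ 2)); last first.
    by rewrite sum_nat_const mulnC mulnCA leq_mul2l ltnW ?orbT.
  apply: leq_sum => x _; rewrite -mulnn; apply: npairs_leq => y.
  exact: max_card.
have leN' := ntriples_avoid_sym A symT.
apply: (@disjoint_St3S _ (avoid T A)); first by move=> x y z /andP[].
rewrite -/N in leN'.
apply: disjoint_St3_low_degree => //; try lia.
- exact: avoid_symmetric3.
- exact: avoid_irreflexive3.
move=> x; have [xA|] := boolP (x \in A).
  rewrite /npairs big1 // => y _; rewrite big1 // => z _.
  by rewrite /avoid xA !andbF.
rewrite inE -leqNgt.
have : npairs (avoid T A x) <= npairs (T x) by apply: npairsS => y z /andP[].
move=> le1 le2.
have : npairs (avoid T A x) * (120 * (m * h)) <= N.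
  by apply: leq_trans le2; rewrite leq_mul2r le1 orbT.
lia.
Qed.

Definition edge_triple (G : {set {set V}}) (x y z : V) := [set x; y; z] \in G.

Lemma edge_triple_symmetric3 G : symmetric3 (edge_triple G).
Proof.
by split=> x y z; rewrite /edge_triple; [rewrite [[set x; y]]setUC|rewrite setUAC].
Qed.

Lemma edge_triple_irreflexive3 G : uniform 3 G -> irreflexive3 (edge_triple G).
Proof.
move=> G3 x y; apply/negP => /G3; rewrite -setUA setUid cards2.
by case: (x != y).
Qed.

(** Sending an ordered triple to the set of its entries reaches every edge. *)
Lemma card_edges_leq_ntriples (G : {set {set V}}) :
  uniform 3 G -> #|G| <= ntriples (edge_triple G).
Proof.
move=> G3; pose S := [set p : V * (V * V) | edge_triple G p.1 p.2.1 p.2.2].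
have <- : #|S| = ntriples (edge_triple G).
  rewrite -sum_indicator /ntriples /npairs.
  by rewrite [RHS](eq_bigr _ (fun x _ => pair_bigA _ _)) pair_bigA.
apply: leq_trans (leq_imset_card (fun p => [set p.1; p.2.1; p.2.2]) S).
apply: subset_leq_card; apply/subsetP => e eG.
have [x xe] : exists x, x \in e by apply/card_gt0P; rewrite G3.
have : #|e :\ x| == 2 by have := cardsD1 x e; rewrite G3 // xe add1n => -[<-].
case/cards2P=> y [z [_ Ee]].
have {}Ee : e = [set x; y; z] by rewrite -(setD1K xe) Ee setUA.
by apply/imsetP; exists (x, (y, z)); rewrite ?inE /edge_triple /= -?Ee.
Qed.

Lemma has_disjoint_copies_St3 (G : {set {set V}}) (m h k : nat) :
  disjoint_St3 (edge_triple G) m h k -> has_disjoint_copies m (St3 h k) G.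
Proof.
case=> F [FT FF]; exists F; split=> // i; have [F_inj FG] := FT i.
split=> // e /imsetP[e1 /imset2P[r e2 _ /imsetP[j _ ->] ->] ->].
have := FG r j; rewrite /edge_triple.
by rewrite -setUA !imsetU1 !imset_set1.
Qed.

End ThreeGraphs.

(** * Real parameters: from [s] and [t] to a whole number of copies *)

Import Order.TTheory GRing.Theory Num.Theory.
Local Open Scope ring_scope.

Theorem theorem5p2 (R : realType) :
  exists C : R, 0 < C /\
    forall (n h k : nat) (s : R),
      (0 < n)%N -> (0 < h)%N -> (0 < k)%N ->
      Num.max k%:R (h%:R ^+ 2 * k%:R ^+ 2 / n%:R) <= s ->
      forall (V : finType) (G : {set {set V}}),
        #|V| = n -> uniform 3 G ->
        C * s * n%:R ^+ 2 <= #|G|%:R ->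
        exists m : nat,
          Num.min s (Num.min (Num.sqrt (s * n%:R) / h%:R)
                       (s `^ (1 / 3) * n%:R `^ (2 / 3) / (h%:R * k%:R)))
            <= m%:R
          /\ has_disjoint_copies m (St3 h k) G.
Proof.
(* The requirement [20 * (90 * (m * h * k)) ^ 3 <= N] is the most demanding one; as the cube of
   [m * h * k] will be at most [8 * s * n ^ 2], it asks for 20 times 8 times the cube of 90. *)
exists (160 * 90 ^+ 3); split; first by rewrite mulr_gt0 ?exprn_gt0 ?ltr0n.
move=> n h k s n0 h0 k0; rewrite ge_max => /andP[le_ks le_hks] V G cV G3 leG.
have nR : 0 < n%:R :> R by rewrite ltr0n.
have hR : 0 < h%:R :> R by rewrite ltr0n.
have kR : 0 < k%:R :> R by rewrite ltr0n.
have k1 : 1 <= k%:R :> R by rewrite ler1n.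
have s1 : 1 <= s by apply: le_trans le_ks.
have s0 : 0 < s by apply: lt_le_trans s1.
have {}le_hks : h%:R ^+ 2 * k%:R ^+ 2 <= s * n%:R by rewrite -ler_pdivrMr.
set N := ntriples (edge_triple G).
have leN : 160 * 90 ^+ 3 * (s * n%:R ^+ 2) <= N%:R.
  by rewrite mulrA (le_trans leG) // ler_nat card_edges_leq_ntriples.
have sn2 : 0 < s * n%:R ^+ 2 by rewrite mulr_gt0 ?exprn_gt0.
have N0 : (0 < N)%N.
  by rewrite -(ltr0n R); apply: lt_le_trans leN; rewrite mulr_gt0 //; lra.
have le_Nn : (N <= n ^ 3)%N by rewrite -cV ntriples_leq.
have le_sn : s <= n%:R.
  have : N%:R <= n%:R ^+ 3 :> R by rewrite -natrX ler_nat.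
  move/(le_trans leN) => le_n3.
  rewrite -(ler_pM2r (exprn_gt0 2 nR)) -exprS; apply: le_trans le_n3.
  by rewrite ler_peMl ?ltW //; lra.
set r := s `^ (1 / 3) * n%:R `^ (2 / 3).
have r0 : 0 < r by rewrite mulr_gt0 ?powR_gt0.
have r3 : r ^+ 3 = s * n%:R ^+ 2.
  rewrite exprMn -!powR_mulrn ?powR_ge0 // -!powRrM.
  have -> : 1 / 3 * 3 = 1 :> R by lra.
  have -> : 2 / 3 * 3 = 2 :> R by lra.
  by rewrite powRr1 ?ltW // powR_mulrn ?ltW.
set q := Num.sqrt (s * n%:R).
have q2 : q ^+ 2 = s * n%:R by rewrite sqr_sqrtr // mulr_ge0 ?ltW.
have q0 : 0 < q by rewrite sqrtr_gt0 mulr_gt0.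
have le_hkq : h%:R * k%:R <= q.
  rewrite -(@ler_pXn2r R 2) ?nnegrE ?mulr_ge0 ?(ltW q0) //.
  by rewrite exprMn q2.
(* Comparing sixth powers, [s ^ 3 * n ^ 3 <= s ^ 2 * n ^ 4] amounts to [s <= n]. *)
have le_qr : q <= r.
  rewrite -(@ler_pXn2r R 6) ?nnegrE ?(ltW q0) ?(ltW r0) //.
  rewrite -[6%N]/(2 * 3)%N exprM q2.
  rewrite (mulnC 2) exprM r3.
  have -> : (s * n%:R) ^+ 3 = s ^+ 2 * n%:R ^+ 3 * s by ring.
  have -> : (s * n%:R ^+ 2) ^+ 2 = s ^+ 2 * n%:R ^+ 3 * n%:R by ring.
  by rewrite ler_pM2l // mulr_gt0 ?exprn_gt0.
set t := Num.min s (Num.min (q / h%:R) (r / (h%:R * k%:R))).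
(* This makes rounding up harmless: the integer [m] just above [t] is at most [t + 1], hence at most
   [2 * t]. *)
have t1 : 1 <= t.
  have le_hq : h%:R <= q by apply: le_trans le_hkq; rewrite ler_peMr // ltW.
  have le_hkr := le_trans le_hkq le_qr.
  by rewrite !le_min s1 !ler_pdivlMr ?mul1r ?le_hq ?le_hkr ?mulr_gt0.
have [t_s t_q t_r] : [/\ t <= s, t * h%:R <= q & t * (h%:R * k%:R) <= r].
  by rewrite -!ler_pdivlMr ?mulr_gt0 // /t !ge_min !lexx !orbT.
have /andP[] := truncn_itv (le_trans ler01 t1).
set m := (Num.truncn t).+1 => le_mt /ltW le_tm.
have {}le_mt : m%:R <= 2 * t by rewrite /m -natr1; lra.
exists m; split=> //; apply: has_disjoint_copies_St3.
have m0 : 0 <= m%:R :> R by [].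
have mh : m%:R * h%:R <= 2 * q.
  by apply: (@le_trans _ _ (2 * t * h%:R)); [rewrite ler_pM2r|lra].
have mhk : m%:R * h%:R * k%:R <= 2 * r.
  rewrite -mulrA; apply: (@le_trans _ _ (2 * t * (h%:R * k%:R))); last by lra.
  by rewrite ler_pM2r ?mulr_gt0.
(* From here on, each quantity that must stay below [N] is bounded by a constant times [s * n ^ 2],
   which makes the remaining goals linear. *)
have {}mh : (m%:R * h%:R) ^+ 2 * n%:R <= 4 * (s * n%:R ^+ 2).
  have -> : 4 * (s * n%:R ^+ 2) = (2 * q) ^+ 2 * n%:R.
    by rewrite exprMn q2; ring.
  by rewrite ler_pM2r // ler_pXn2r ?nnegrE ?mulr_ge0 ?(ltW q0).
have {}mhk : (m%:R * h%:R * k%:R) ^+ 3 <= 8 * (s * n%:R ^+ 2).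
  have -> : 8 * (s * n%:R ^+ 2) = (2 * r) ^+ 3 by rewrite exprMn r3; ring.
  by rewrite ler_pXn2r ?nnegrE ?mulr_ge0 ?powR_ge0.
have hk : h%:R ^+ 2 * k%:R ^+ 2 * n%:R <= s * n%:R ^+ 2.
  by rewrite (expr2 n%:R) mulrA ler_pM2r.
have nk : n%:R ^+ 2 * k%:R <= s * n%:R ^+ 2.
  by rewrite mulrC ler_pM2r ?exprn_gt0.
have nm : n%:R ^+ 2 * m%:R <= 2 * (s * n%:R ^+ 2).
  by rewrite mulrC mulrA ler_pM2r ?exprn_gt0 //; lra.
apply: disjoint_St3_of_ntriples; rewrite -/N ?cV //.
- exact: edge_triple_symmetric3.
- exact: edge_triple_irreflexive3.
- rewrite -(ler_nat R) !(natrM, natrX) exprMn; lra.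
- rewrite -(ler_nat R) !(natrM, natrX) -exprMn; lra.
- rewrite -(ler_nat R) !(natrM, natrX); lra.
- rewrite -(ler_nat R) !(natrM, natrX); lra.
- rewrite -(ler_nat R) !(natrM, natrX); lra.
Qed.
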